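(* Let $\mathfrak{D}$ be the group generated by $\tau$ and $\iota$, acting on $\mathbb{C}[\mathfrak{X}]=\mathbb{C}[\mathrm{SL}(3,\mathbb{C})\times\mathrm{SL}(3,\mathbb{C})]^{\mathrm{SL}(3,\mathbb{C})}$, and let $R$ be the ring generated by $t_{(\pm i)}$, $1\le i\le 4$. Then $\mathfrak{D}$ restricted to $R$ is group isomorphic to the dihedral group $D_4$ of order $8$. Moreover, the algebraically independent generators are characterized as those which $\mathfrak{D}$ acts on as a permutation group.
   Context: Let $G=\mathrm{SL}(3,\mathbb{C})$ act on $G\times G$ by simultaneous conjugation, let $\mathbb{C}[\mathfrak{X}]=\mathbb{C}[G\times G]^G$ be the ring of invariants, and let $\mathbf{x}_1,\mathbf{x}_2$ be the generic unimodular $3\times 3$ matrices of the two factors. Put $t_{(1)}=\mathrm{tr}(\mathbf{x}_1)$, $t_{(-1)}=\mathrm{tr}(\mathbf{x}_1^{-1})$, $t_{(2)}=\mathrm{tr}(\mathbf{x}_2)$, $t_{(-2)}=\mathrm{tr}(\mathbf{x}_2^{-1})$, $t_{(3)}=\mathrm{tr}(\mathbf{x}_1\mathbf{x}_2)$, $t_{(-3)}=\mathrm{tr}(\mathbf{x}_1^{-1}\mathbf{x}_2^{-1})$, $t_{(4)}=\mathrm{tr}(\mathbf{x}_1\mathbf{x}_2^{-1})$, $t_{(-4)}=\mathrm{tr}(\mathbf{x}_1^{-1}\mathbf{x}_2)$, $t_{(5)}=\mathrm{tr}(\mathbf{x}_1\mathbf{x}_2\mathbf{x}_1^{-1}\mathbf{x}_2^{-1})$.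 These nine elements generate $\mathbb{C}[\mathfrak{X}]$ as a $\mathbb{C}$-algebra; they are the generators referred to in the claim. The eight elements $t_{(\pm i)}$, $1\le i\le 4$, are algebraically independent over $\mathbb{C}$, so $R=\mathbb{C}[t_{(\pm 1)},t_{(\pm 2)},t_{(\pm 3)},t_{(\pm 4)}]$ is a polynomial ring, viewed as a subring of $\mathbb{C}[\mathfrak{X}]$. Let $F_2$ be the free group on $\mathtt{x}_1,\mathtt{x}_2$. For $\mathtt{w}\in F_2$ let $\mathbf{w}$ be the matrix word obtained by substituting $\mathbf{x}_i$ for $\mathtt{x}_i$. Each $\alpha\in\mathrm{Aut}(F_2)$ acts on $\mathbb{C}[\mathfrak{X}]$ by the endomorphism extending $\mathrm{tr}(\mathbf{w})\mapsto\mathrm{tr}(\alpha(\mathbf{w}))$; inner automorphisms act trivially, so $\mathrm{Out}(F_2)$ acts on $\mathbb{C}[\mathfrak{X}]$. $\mathfrak{D}$ is the subgroup generated by $\tau:\mathtt{x}_1\mapsto\mathtt{x}_2,\ \mathtt{x}_2\mapsto\mathtt{x}_1$ and $\iota:\mathtt{x}_1\mapsto\mathtt{x}_1^{-1},\ \mathtt{x}_2\mapsto\mathtt{x}_2$. The action of $\mathfrak{D}$ preserves $R$, and ''$\mathfrak{D}$ restricted to $R$'' refers to the induced action on $R$. *)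

(* Defs.v *)
From HB Require Import structures.
From mathcomp Require Import all_boot all_order all_algebra all_fingroup.
From mathcomp Require Import all_solvable.
From mathcomp Require Import complex.
From mathcomp Require Import boolp classical_sets functions reals.

Set Implicit Arguments.
Unset Strict Implicit.
Unset Printing Implicit Defensive.

Import GRing.Theory.

Local Open Scope classical_set_scope.
Local Open Scope group_scope.

Section FreeGroup.
Variable X : choiceType.

(* The letter (x, b) stands for x if b = false and for x^-1 if b = true. *)
Definition letterV (a : X * bool) : X * bool := (a.1, ~~ a.2).

Definition reduced (w : seq (X * bool)) : bool :=
  sorted (fun a b => b != letterV a) w.

Definition push (a : X * bool) (w : seq (X * bool)) : seq (X * bool) :=
  if w is b :: w' then if b == letterV a then w' else a :: w else [:: a].

Lemma letterVK : involutive letterV.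
Proof. by case=> x b; rewrite /letterV /= negbK. Qed.

Lemma push_reduced a w : reduced w -> reduced (push a w).
Proof.
case: w => //= b w; case: ifP => [_ /path_sorted //|/negbT nba].
by rewrite /reduced /= nba.
Qed.

Lemma pushVK a w : reduced w -> push (letterV a) (push a w) = w.
Proof.
case: w => [_|b w] /=; first by rewrite letterVK eqxx.
case: eqP => [-> |_ _] /=; last by rewrite letterVK eqxx.
case: w => [|c w] //=; rewrite /reduced /= letterVK => /andP[/negbTE-> _] //.
Qed.

Lemma pushKV a w : reduced w -> push a (push (letterV a) w) = w.
Proof. by rewrite -{1}[a]letterVK; apply: pushVK. Qed.

Lemma pushs_reduced u w : reduced w -> reduced (foldr push w u).
Proof. by move=> rw; elim: u => //= a u; apply: push_reduced. Qed.

Lemma pushs_push a u w : reduced w ->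
  foldr push w (push a u) = push a (foldr push w u).
Proof.
move=> rw; case: u => //= b u; case: eqP => //= ->.
by rewrite pushKV ?pushs_reduced.
Qed.

Lemma pushsA u v w : reduced w ->
  foldr push w (foldr push v u) = foldr push (foldr push w v) u.
Proof. by move=> rw; elim: u => //= a u IH; rewrite pushs_push ?IH. Qed.

Lemma push_path a w : reduced (a :: w) -> push a w = a :: w.
Proof. by case: w => //= b w /andP[/negbTE->]. Qed.

Lemma pushs_nil w : reduced w -> foldr push [::] w = w.
Proof.
elim: w => //= a w IH raw; rewrite IH; last exact: path_sorted raw.
exact: push_path.
Qed.

Record freeGroup := FreeGroup {
  fg_word : seq (X * bool);
  fg_wordP : reduced fg_word }.
HB.instance Definition _ := [isSub for fg_word].
HB.instance Definition _ := [Equality of freeGroup by <:].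
HB.instance Definition _ := [Choice of freeGroup by <:].

Definition fg_one : freeGroup := @FreeGroup [::] isT.

(* The product of reduced words is the free reduction of u ++ v. *)
Definition fg_mul (u v : freeGroup) : freeGroup :=
  FreeGroup (pushs_reduced (fg_word u) (fg_wordP v)).

Lemma reducedV w : reduced w -> reduced (rev (map letterV w)).
Proof.
rewrite /reduced rev_sorted sorted_map => rw; apply: sub_sorted rw => a b /=.
by apply: contraNneq => /(can_inj letterVK) ->; rewrite letterVK.
Qed.

Definition fg_inv (u : freeGroup) : freeGroup :=
  FreeGroup (reducedV (fg_wordP u)).

Lemma fg_mulA : associative fg_mul.
Proof. by move=> u v w; apply: val_inj; rewrite /= pushsA //; apply: valP. Qed.

Lemma fg_mul1 : left_id fg_one fg_mul.
Proof. by move=> u; apply: val_inj. Qed.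

Lemma fg_mulr1 : right_id fg_one fg_mul.
Proof. by move=> u; apply: val_inj; rewrite /= pushs_nil //; apply: valP. Qed.

Lemma fg_invK : involutive fg_inv.
Proof.
move=> u; apply: val_inj; rewrite /= map_rev revK -map_comp.
by rewrite (eq_map letterVK) map_id.
Qed.

Lemma fg_mulV : left_inverse fg_one fg_inv fg_mul.
Proof.
case=> u ru; apply: val_inj => /= {ru}.
elim: u => //= a u IH; rewrite rev_cons -cats1 foldr_cat /=.
by rewrite letterVK eqxx.
Qed.

Lemma fg_mulrV : right_inverse fg_one fg_inv fg_mul.
Proof. by move=> u; rewrite -{1}[u]fg_invK fg_mulV. Qed.

HB.instance Definition _ := isGroup.Build freeGroup
  fg_mulA fg_mul1 fg_mulr1 fg_mulV fg_mulrV.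

Definition fg_gen (x : X) : freeGroup := @FreeGroup [:: (x, false)] isT.

End FreeGroup.

Arguments fg_gen {X} x.

(* The extension of f : X -> H to a morphism freeGroup X -> H. *)
Section Lift.
Variables (X : choiceType) (H : groupType) (f : X -> H).

Definition letter_val (a : X * bool) : H :=
  if a.2 then (f a.1)^-1 else f a.1.

Definition fg_lift (w : freeGroup X) : H :=
  \prod_(a <- fg_word w) letter_val a.

Lemma fg_lift_gen x : fg_lift (fg_gen x) = f x.
Proof. by rewrite /fg_lift big_seq1. Qed.

Lemma letter_valV a : letter_val (letterV a) = (letter_val a)^-1.
Proof. by case: a => x [] //=; rewrite /letter_val /= invgK. Qed.

Lemma prod_push a w :
  \prod_(b <- push a w) letter_val b = letter_val a * \prod_(b <- w) letter_val b.
Proof.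
case: w => [|b w] /=; first by rewrite !(big_cons, big_nil).
by case: eqP => [->|_]; rewrite !big_cons // letter_valV mulKVg.
Qed.

Lemma fg_liftM : {morph fg_lift : u v / u * v}.
Proof.
move=> u v; rewrite /fg_lift /=.
elim: (fg_word u) => [|a s IH] /=; first by rewrite big_nil mul1g.
by rewrite prod_push IH big_cons mulgA.
Qed.

HB.instance Definition _ :=
  isMultiplicative.Build (freeGroup X) H fg_lift fg_liftM.

End Lift.

Section LiftUniq.
Variables (X : choiceType) (H : groupType).

Lemma gmorph_one (G : groupType) (g : G -> H) : {morph g : u v / u * v} -> g 1 = 1.
Proof. by move=> gM; apply: (@mulgI _ (g 1)); rewrite -gM !mulg1. Qed.

Lemma gmorph_inv (G : groupType) (g : G -> H) : {morph g : u v / u * v} ->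
  forall x, g x^-1 = (g x)^-1.
Proof.
move=> gM x; apply: (@mulgI _ (g x)); rewrite -gM !mulgV.
exact: gmorph_one.
Qed.

Lemma fg_ext (g h : freeGroup X -> H) :
  {morph g : u v / u * v} -> {morph h : u v / u * v} ->
  (forall x, g (fg_gen x) = h (fg_gen x)) -> g =1 h.
Proof.
move=> gM hM gh [w rw]; elim: w rw => [|[x b] w IH] rw.
  rewrite (_ : FreeGroup rw = 1); last exact: val_inj.
  by rewrite !gmorph_one.
have rw' : reduced w by apply: path_sorted rw.
pose a : freeGroup X := if b then (fg_gen x)^-1 else fg_gen x.
have -> : FreeGroup rw = a * FreeGroup rw'.
  apply: val_inj; rewrite /a; case: b rw {a} => rw /=; exact/esym/push_path.
rewrite gM hM IH /a; congr (_ * _).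
by case: ifP; rewrite ?gmorph_inv // gh.
Qed.

End LiftUniq.

Section SymmetricGroup.
Variable T : Type.

Record symT := SymT {
  sym_fun :> T -> T;
  sym_inv : T -> T;
  symK : cancel sym_fun sym_inv;
  symVK : cancel sym_inv sym_fun }.

Lemma symP (s t : symT) : s =1 t -> s = t.
Proof.
case: s t => [f f' fK f'K] [g g' gK g'K] /= /funext fg; subst g.
have E : f' = g' by apply/funext=> x; rewrite -{2}[x]f'K gK.
by subst g'; congr SymT; apply: Prop_irrelevance.
Qed.

HB.instance Definition _ := gen_eqMixin symT.
HB.instance Definition _ := gen_choiceMixin symT.

Definition sym_one : symT := @SymT id id (fun=> erefl) (fun=> erefl).
(* Unlike for mathcomp's 'S_n, products compose from right to left. *)
Definition sym_mul (s t : symT) : symT :=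
  @SymT (s \o t) (sym_inv t \o sym_inv s)
    (can_comp (@symK s) (@symK t)) (can_comp (@symVK t) (@symVK s)).
Definition sym_opp (s : symT) : symT := SymT (@symVK s) (@symK s).

Lemma sym_mulA : associative sym_mul.
Proof. by move=> s t u; apply: symP. Qed.
Lemma sym_mul1 : left_id sym_one sym_mul.
Proof. by move=> s; apply: symP. Qed.
Lemma sym_mulr1 : right_id sym_one sym_mul.
Proof. by move=> s; apply: symP. Qed.
Lemma sym_mulV : left_inverse sym_one sym_opp sym_mul.
Proof. by move=> s; apply: symP => x /=; rewrite symK. Qed.
Lemma sym_mulrV : right_inverse sym_one sym_opp sym_mul.
Proof. by move=> s; apply: symP => x /=; rewrite symVK. Qed.

HB.instance Definition _ := isGroup.Build symT
  sym_mulA sym_mul1 sym_mulr1 sym_mulV sym_mulrV.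

End SymmetricGroup.

Section GroupAut.
Variable G : groupType.

Definition is_gaut : pred (symT G) := fun s => `[< {morph s : x y / x * y} >].

Record grpAut := GrpAut { gaut_sym :> symT G; gaut_symP : gaut_sym \in is_gaut }.
HB.instance Definition _ := [isSub for gaut_sym].
HB.instance Definition _ := [Choice of grpAut by <:].

Lemma gautM (s : grpAut) : {morph s : x y / x * y}.
Proof. exact/asboolP/(gaut_symP s). Qed.

Lemma gaut_closed : group_closed is_gaut.
Proof.
split=> [|s t /asboolP sM /asboolP tM]; apply/asboolP => // x y /=.
rewrite -sM; congr (s _); apply: (can_inj (@symK _ t)).
by rewrite tM !symVK.
Qed.

HB.instance Definition _ :=
  SubChoice_isSubGroup.Build (symT G) is_gaut grpAut gaut_closed.

End GroupAut.

Section AlgAut.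
Variables (K : comNzRingType) (A : algType K).

Definition is_algaut : pred (symT A) :=
  fun s => `[< linear s /\ GRing.monoid_morphism s >].

Record algAut := AlgAut {
  algaut_sym :> symT A;
  algaut_symP : algaut_sym \in is_algaut }.
HB.instance Definition _ := [isSub for algaut_sym].
HB.instance Definition _ := [Choice of algAut by <:].

Lemma algaut_closed : group_closed is_algaut.
Proof.
split=> [|s t]; first by apply/asboolP.
case/asboolP=> sL [s1 sM] /asboolP[tL [t1 tM]]; apply/asboolP.
split; [move=> k x y /= | split => [|x y] /=].
- by rewrite -sL; congr (s _); apply: (can_inj (@symK _ t)); rewrite tL !symVK.
- by rewrite -[RHS]s1; congr (s _); apply: (can_inj (@symK _ t)); rewrite t1 symVK.
- by rewrite -sM; congr (s _); apply: (can_inj (@symK _ t)); rewrite tM !symVK.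
Qed.

HB.instance Definition _ :=
  SubChoice_isSubGroup.Build (symT A) is_algaut algAut algaut_closed.

End AlgAut.

Definition gen_subgroup (G : groupType) (S : set G) : set G :=
  [set g | forall H : {pred G}, group_closed H ->
             (forall s, S s -> s \in H) -> g \in H].

Definition set_isog (H G : groupType) (S : set G) : Prop :=
  exists2 phi : {multiplicative H -> G}, injective phi & range phi = S.

Section GeneratedSubalgebra.
Variables (K : comNzRingType) (A : algType K) (S : set A).

Definition gen_subalg : {pred A} := fun a =>
  `[< forall B : {pred A}, GRing.subalg_closed B ->
        (forall s, S s -> s \in B) -> a \in B >].

Lemma gen_subalg_sub s : S s -> s \in gen_subalg.
Proof. by move=> Ss; apply/asboolP => B _; apply. Qed.

Lemma gen_subalg_closed : GRing.subalg_closed gen_subalg.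
Proof.
split=> [|k a b /asboolP aS /asboolP bS|a b /asboolP aS /asboolP bS];
  apply/asboolP => B Bcl SB; have [B1 BL BM] := Bcl; first by [].
- by apply: BL; [apply: (aS B) | apply: (bS B)].
- by apply: BM; [apply: (aS B) | apply: (bS B)].
Qed.

Lemma gen_subalg_semiclosed : GRing.subsemialg_closed gen_subalg.
Proof. exact: GRing.subalg_closed_semi gen_subalg_closed. Qed.

Record subalg := Subalg {
  subalg_val :> A;
  subalg_valP : subalg_val \in gen_subalg }.
HB.instance Definition _ := [isSub for subalg_val].
HB.instance Definition _ := [Choice of subalg by <:].
HB.instance Definition _ := GRing.SubChoice_isSubAlgebra.Build
  K A gen_subalg subalg gen_subalg_semiclosed.

End GeneratedSubalgebra.

Section FunAlg.
Variables (T : pointedType) (K : comNzRingType).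

Definition funAlg : Type := T -> K^o.
HB.instance Definition _ := GRing.NzRing.copy funAlg (T -> K).
HB.instance Definition _ := GRing.Lmodule.copy funAlg (T -> K^o).

Lemma funAlg_scaleAl (k : K) (f g : funAlg) : (k *: (f * g) = (k *: f) * g)%R.
Proof. by apply/funext=> x; apply: mulrA. Qed.
HB.instance Definition _ :=
  GRing.LSemiModule_isLSemiAlgebra.Build K funAlg funAlg_scaleAl.
Lemma funAlg_scaleAr (k : K) (f g : funAlg) : (k *: (f * g) = f * (k *: g))%R.
Proof. by apply/funext=> x; apply: mulrCA. Qed.
HB.instance Definition _ := GRing.Lalgebra_isAlgebra.Build K funAlg funAlg_scaleAr.
Lemma funAlg_mulC (f g : funAlg) : (f * g = g * f)%R.
Proof. by apply/funext=> x; apply: mulrC. Qed.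
End FunAlg.

Section SpecialLinear.
Variables (K : fieldType) (n : nat).
Local Open Scope ring_scope.

Record SL := MkSL { sl_mx :> 'M[K]_n; sl_mxP : \det sl_mx == 1 }.
HB.instance Definition _ := [isSub for sl_mx].
HB.instance Definition _ := [Choice of SL by <:].

Lemma sl_det (A : SL) : \det A = 1.
Proof. exact/eqP/sl_mxP. Qed.
Lemma sl_unit (A : SL) : (A : 'M_n) \in unitmx.
Proof. by rewrite unitmxE sl_det unitr1. Qed.

Lemma sl_one_subproof : \det (1%:M : 'M[K]_n) == 1. Proof. by rewrite det1. Qed.
Lemma sl_mul_subproof (A B : SL) : \det (A *m B) == 1.
Proof. by rewrite det_mulmx !sl_det mulr1. Qed.
Lemma sl_inv_subproof (A : SL) : \det (invmx A) == 1.
Proof. by rewrite det_inv sl_det invr1. Qed.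

Definition sl_one : SL := MkSL sl_one_subproof.
Definition sl_mul (A B : SL) : SL := MkSL (sl_mul_subproof A B).
Definition sl_inv (A : SL) : SL := MkSL (sl_inv_subproof A).

Lemma sl_mulA : associative sl_mul.
Proof. by move=> A B C; apply/val_inj/mulmxA. Qed.
Lemma sl_mul1 : left_id sl_one sl_mul.
Proof. by move=> A; apply/val_inj/mul1mx. Qed.
Lemma sl_mulr1 : right_id sl_one sl_mul.
Proof. by move=> A; apply/val_inj/mulmx1. Qed.
Lemma sl_mulV : left_inverse sl_one sl_inv sl_mul.
Proof. by move=> A; apply/val_inj; rewrite /= mulVmx ?sl_unit. Qed.
Lemma sl_mulrV : right_inverse sl_one sl_inv sl_mul.
Proof. by move=> A; apply/val_inj; rewrite /= mulmxV ?sl_unit. Qed.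

HB.instance Definition _ := isGroup.Build SL
  sl_mulA sl_mul1 sl_mulr1 sl_mulV sl_mulrV.
HB.instance Definition _ := isPointed.Build SL sl_one.

End SpecialLinear.

Notation F2 := (freeGroup 'I_2).
Definition x1 : F2 := fg_gen ord0.
Definition x2 : F2 := fg_gen ord_max.

(* The endomorphism of F2 with x1 |-> u, x2 |-> v. *)
Definition F2_endo (u v : F2) : F2 -> F2 :=
  fg_lift (fun i : 'I_2 => if i == ord0 then u else v).

Lemma F2_endoM u v : {morph F2_endo u v : a b / a * b}.
Proof. exact: fg_liftM. Qed.
Lemma F2_endo1 u v : F2_endo u v x1 = u.
Proof. by rewrite /F2_endo fg_lift_gen. Qed.
Lemma F2_endo2 u v : F2_endo u v x2 = v.
Proof. by rewrite /F2_endo fg_lift_gen. Qed.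
Lemma F2_endoV u v w : F2_endo u v w^-1 = (F2_endo u v w)^-1.
Proof. by rewrite (gmorph_inv (F2_endoM u v)). Qed.

Lemma F2_ext (H : groupType) (g h : F2 -> H) :
  {morph g : u v / u * v} -> {morph h : u v / u * v} ->
  g x1 = h x1 -> g x2 = h x2 -> g =1 h.
Proof.
move=> gM hM g1 g2; apply: fg_ext => // -[[|[|//]] lt_i2].
- by rewrite (_ : Ordinal lt_i2 = ord0) //; apply: val_inj.
- by rewrite (_ : Ordinal lt_i2 = ord_max) //; apply: val_inj.
Qed.

Definition tau_fun : F2 -> F2 := F2_endo x2 x1.
Definition iota_fun : F2 -> F2 := F2_endo x1^-1 x2.

Lemma tau_funK : cancel tau_fun tau_fun.
Proof.
by apply: F2_ext => [u v|u v| |] //; rewrite /= /tau_fun ?F2_endoM //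
  ?F2_endo1 ?F2_endo2 ?F2_endo1.
Qed.

Lemma iota_funK : cancel iota_fun iota_fun.
Proof.
by apply: F2_ext => [u v|u v| |] //; rewrite /= /iota_fun ?F2_endoM //
  ?F2_endo1 ?F2_endo2 // F2_endoV F2_endo1 invgK.
Qed.

Definition tau_sym : symT F2 := SymT tau_funK tau_funK.
Definition iota_sym : symT F2 := SymT iota_funK iota_funK.

Lemma tau_symP : tau_sym \in @is_gaut F2.
Proof. exact/asboolP/F2_endoM. Qed.
Lemma iota_symP : iota_sym \in @is_gaut F2.
Proof. exact/asboolP/F2_endoM. Qed.

Definition tau : grpAut F2 := GrpAut tau_symP.
Definition iota : grpAut F2 := GrpAut iota_symP.

Definition frakD : set (grpAut F2) := gen_subgroup [set tau; iota].

Section CharacterRing.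
Variable K : fieldType.
Local Notation G := (SL K 3).
Local Notation Fun := (funAlg (G * G)%type K).

(* The coordinate ring K[G x G] as a ring of functions. This is the image of *)
(* the polynomial ring in the 18 matrix entries; it is used for K = C only.  *)
Definition matrix_entries : set Fun :=
  [set f | exists i j,
     f = (fun p : G * G => p.1 i j) \/ f = (fun p : G * G => p.2 i j)].
Definition regular : {pred Fun} := gen_subalg matrix_entries.

HB.instance Definition _ := GRing.isSubalgClosed.Build K Fun regular
  (gen_subalg_closed matrix_entries).

Definition conj_pair (g : G) (p : G * G) : G * G :=
  (g * p.1 * g^-1, g * p.2 * g^-1).

Definition regular_invariant : {pred Fun} := fun f =>
  (f \in regular) && `[< forall g p, f (conj_pair g p) = f p >].

Lemma regular_invariantP (f : Fun) :
  reflect (f \in regular /\ forall g p, f (conj_pair g p) = f p)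
          (f \in regular_invariant).
Proof.
by apply: (iffP andP) => -[fr fi]; split=> //; [apply/asboolP | apply/asboolP].
Qed.

Lemma regular_invariant_closed : GRing.subalg_closed regular_invariant.
Proof.
have [r1 rL rM] := gen_subalg_closed matrix_entries.
split=> [|k f h|f h]; first exact/regular_invariantP.
- case/regular_invariantP=> fr fi /regular_invariantP[hr hi].
  apply/regular_invariantP; split; first exact: rL.
  by move=> g p; rewrite [LHS](congr2 (fun a b => k *: a + b)%R (fi g p) (hi g p)).
- case/regular_invariantP=> fr fi /regular_invariantP[hr hi].
  apply/regular_invariantP; split; first exact: rM.
  by move=> g p; rewrite [LHS](congr2 (fun a b => a * b)%R (fi g p) (hi g p)).
Qed.

Lemma regular_invariant_semiclosed : GRing.subsemialg_closed regular_invariant.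
Proof. exact: GRing.subalg_closed_semi regular_invariant_closed. Qed.

(* The ring of invariants K[G x G]^G, i.e. C[X] for K = C. *)
Record charRing := CharRing {
  char_fun :> Fun;
  char_funP : char_fun \in regular_invariant }.
HB.instance Definition _ := [isSub for char_fun].
HB.instance Definition _ := [Choice of charRing by <:].
HB.instance Definition _ := GRing.SubChoice_isSubAlgebra.Build
  K Fun regular_invariant charRing regular_invariant_semiclosed.

(* The value of the word w at x1 = p.1, x2 = p.2. *)
Definition eval_word (p : G * G) (w : F2) : G :=
  fg_lift (fun i : 'I_2 => if i == ord0 then p.1 else p.2) w.

Lemma eval_wordM p : {morph eval_word p : u v / u * v}.
Proof. exact: fg_liftM. Qed.
Lemma eval_wordV p w : eval_word p w^-1 = (eval_word p w)^-1.
Proof. by rewrite (gmorph_inv (eval_wordM p)). Qed.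
Lemma eval_word1 p : eval_word p x1 = p.1.
Proof. by rewrite /eval_word fg_lift_gen. Qed.
Lemma eval_word2 p : eval_word p x2 = p.2.
Proof. by rewrite /eval_word fg_lift_gen. Qed.

Lemma eval_word_conj g p w :
  eval_word (conj_pair g p) w = g * eval_word p w * g^-1.
Proof.
move: w; apply: F2_ext => [u v|u v||].
- exact: eval_wordM.
- by rewrite eval_wordM !mulgA mulgVK.
- by rewrite !eval_word1.
- by rewrite !eval_word2.
Qed.

Lemma regular_sum (I : finType) (F : I -> Fun) :
  (forall i, F i \in regular) -> ((fun p => \sum_i F i p)%R : Fun) \in regular.
Proof.
move=> Fr; have : (\sum_i F i)%R \in regular by apply: rpred_sum.
by congr (_ \in regular); apply: fct_sumE.
Qed.

Lemma regular_prod (I : finType) (F : I -> Fun) :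
  (forall i, F i \in regular) -> ((fun p => \prod_i F i p)%R : Fun) \in regular.
Proof.
move=> Fr; have : (\prod_i F i)%R \in regular by apply: rpred_prod.
by congr (_ \in regular); apply: fct_prodE.
Qed.

Lemma regular_mul (f h : Fun) : f \in regular -> h \in regular ->
  ((fun p => f p * h p)%R : Fun) \in regular.
Proof. by move=> fr hr; apply: (rpredM fr hr). Qed.

Lemma regular_cst (c : K) : ((fun=> c) : Fun) \in regular.
Proof.
have /(rpredZ c) : (1%R : Fun) \in regular by apply: rpred1.
by congr (_ \in regular); apply/funext=> p; apply: mulr1.
Qed.

Lemma regular_det n (F : (G * G)%type -> 'M[K]_n) :
  (forall i j, ((fun p => F p i j) : Fun) \in regular) ->
  ((fun p => \det (F p))%R : Fun) \in regular.
Proof.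
move=> Fr; apply: regular_sum => s; apply: regular_mul; first exact: regular_cst.
by apply: regular_prod.
Qed.

Definition entrywise_regular (F : (G * G)%type -> G) :=
  forall i j, ((fun p => F p i j) : Fun) \in regular.

Lemma entrywise_regularM F H : entrywise_regular F -> entrywise_regular H ->
  entrywise_regular (fun p => F p * H p).
Proof.
move=> Fr Hr i j; rewrite (_ : (fun p => _) = fun p => (\sum_k F p i k * H p k j)%R).
  by apply: regular_sum => k; apply: regular_mul.
by apply/funext=> p; rewrite mxE.
Qed.

Lemma entrywise_regularV F : entrywise_regular F ->
  entrywise_regular (fun p => (F p)^-1).
Proof.
move=> Fr i j; rewrite (_ : (fun p => _) =
  fun p => ((-1) ^+ (j + i) * \det (row' j (col' i (F p))))%R).
  apply: regular_mul; first exact: regular_cst.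
  apply: regular_det => k l.
  rewrite (_ : (fun p => _) = fun p => F p (lift j k) (lift i l)) //.
  by apply/funext=> p; rewrite !mxE.
apply/funext=> p.
by rewrite /= /invmx sl_unit sl_det invr1 scale1r mxE.
Qed.

Lemma entrywise_regular_word w : entrywise_regular (eval_word^~ w).
Proof.
have reg1 b : entrywise_regular (fun p => if b then p.1 else p.2).
  move=> i j; apply: gen_subalg_sub; exists i, j.
  by case: b; [left | right].
case: w => w rw; rewrite /eval_word /fg_lift /= {rw}.
elim: w => [|[x b] w IH].
  move=> i j; rewrite (_ : (fun p => _) = fun=> (1%:M : 'M[K]_3)%R i j).
    exact: regular_cst.
  by apply/funext=> p; rewrite big_nil.
rewrite (_ : (fun p => _) = fun p =>
  letter_val (fun i : 'I_2 => if i == ord0 then p.1 else p.2) (x, b) *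
  \prod_(a <- w) letter_val (fun i : 'I_2 => if i == ord0 then p.1 else p.2) a).
  apply: entrywise_regularM => //; rewrite /letter_val /=.
  by case: b; [apply: entrywise_regularV|]; apply: reg1.
by apply/funext=> p; rewrite big_cons.
Qed.

Definition trace_fun (w : F2) : Fun := fun p => (\tr (eval_word p w))%R.

Lemma trace_funP w : trace_fun w \in regular_invariant.
Proof.
apply/regular_invariantP; split.
  by apply: regular_sum => i; apply: entrywise_regular_word.
move=> g p; rewrite /trace_fun eval_word_conj.
by rewrite /= mxtrace_mulC mulmxA mulVmx ?sl_unit // mul1mx.
Qed.

(* tr(w), for w a word in the generic unimodular matrices. *)
Definition tr_word (w : F2) : charRing := CharRing (trace_funP w).

(* Identifying G x G with Hom(F2, G), this is rho |-> rho \o alpha. *)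
Definition word_map (alpha : grpAut F2) (p : G * G) : G * G :=
  (eval_word p (alpha x1), eval_word p (alpha x2)).

Lemma eval_word_map alpha p w :
  eval_word (word_map alpha p) w = eval_word p (alpha w).
Proof.
move: w; apply: F2_ext => [u v|u v||].
- exact: eval_wordM.
- by rewrite gautM eval_wordM.
- by rewrite eval_word1.
- by rewrite eval_word2.
Qed.

Lemma regular_word_map alpha (f : Fun) :
  f \in regular -> (f \o word_map alpha : Fun) \in regular.
Proof.
have [r1 rL rM] := gen_subalg_closed matrix_entries.
pose B : {pred Fun} := fun f : Fun => (f \o word_map alpha : Fun) \in regular.
move/asboolP/(_ B); apply.
  by split=> [|k g h|g h]; [exact: r1 | exact: rL | exact: rM].
by move=> s [i [j [->|->]]]; apply: entrywise_regular_word.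
Qed.

Lemma word_map_conj alpha g p :
  word_map alpha (conj_pair g p) = conj_pair g (word_map alpha p).
Proof. by rewrite /word_map !eval_word_conj. Qed.

Lemma act_funP alpha (f : charRing) :
  (char_fun f \o word_map alpha : Fun) \in regular_invariant.
Proof.
have /regular_invariantP[fr fi] := char_funP f.
apply/regular_invariantP; split; first exact: regular_word_map.
by move=> g p /=; rewrite word_map_conj fi.
Qed.

Definition act_fun (alpha : grpAut F2) (f : charRing) : charRing :=
  CharRing (act_funP alpha f).

Lemma act_fun_comp (alpha beta : grpAut F2) (f : charRing) :
  act_fun alpha (act_fun beta f) = act_fun (alpha * beta) f.
Proof.
apply/val_inj/funext=> p /=; congr (char_fun f _).
by rewrite {1}/word_map !eval_word_map.
Qed.

Lemma act_fun1 (f : charRing) : act_fun (1 : grpAut F2) f = f.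
Proof.
apply/val_inj/funext=> -[a b] /=; congr (char_fun f _).
by rewrite /word_map /= eval_word1 eval_word2.
Qed.

Lemma act_funK (alpha : grpAut F2) : cancel (act_fun alpha) (act_fun (alpha^-1)%g).
Proof. by move=> f; rewrite act_fun_comp mulVg act_fun1. Qed.
Lemma act_funVK (alpha : grpAut F2) : cancel (act_fun (alpha^-1)%g) (act_fun alpha).
Proof. by move=> f; rewrite act_fun_comp mulgV act_fun1. Qed.

Lemma act_symP (alpha : grpAut F2) :
  SymT (act_funK alpha) (act_funVK alpha) \in @is_algaut K charRing.
Proof. by apply/asboolP; split=> [k f h|]; [|split=> [|f h]]; apply/val_inj. Qed.

(* The left action of Aut(F2) on K[G x G]^G with tr(w) |-> tr(alpha(w)). *)
Definition act (alpha : grpAut F2) : algAut charRing := AlgAut (act_symP alpha).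

Lemma actM : {morph act : alpha beta / alpha * beta}.
Proof.
by move=> alpha beta; apply/val_inj/symP=> f; rewrite /= act_fun_comp.
Qed.

Lemma act_tr alpha w : act alpha (tr_word w) = tr_word (alpha w).
Proof. by apply/val_inj/funext=> p; rewrite /= /trace_fun eval_word_map. Qed.

(* tm_i stands for the generator of index -i. *)
Definition t_1 : charRing := tr_word x1.
Definition tm_1 : charRing := tr_word x1^-1.
Definition t_2 : charRing := tr_word x2.
Definition tm_2 : charRing := tr_word x2^-1.
Definition t_3 : charRing := tr_word (x1 * x2).
Definition tm_3 : charRing := tr_word (x1^-1 * x2^-1).
Definition t_4 : charRing := tr_word (x1 * x2^-1).
Definition tm_4 : charRing := tr_word (x1^-1 * x2).
Definition t_5 : charRing := tr_word (x1 * x2 * x1^-1 * x2^-1).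

Definition indep_generators : set charRing :=
  [set t_1; tm_1; t_2; tm_2; t_3; tm_3; t_4; tm_4].
Definition generators : set charRing := t_5 |` indep_generators.

Definition ringR : algType K := subalg indep_generators.

Lemma tauV : tau^-1 = tau. Proof. exact/val_inj/symP. Qed.
Lemma iotaV : iota^-1 = iota. Proof. exact/val_inj/symP. Qed.

Lemma eq_tr_word (w : F2) (f : charRing) :
  (forall p, trace_fun w p = char_fun f p) -> tr_word w = f.
Proof. by move=> E; apply/val_inj/funext. Qed.

Lemma tr_wordC u v : tr_word (u * v) = tr_word (v * u).
Proof.
by apply: eq_tr_word => p; rewrite /= /trace_fun !eval_wordM /= mxtrace_mulC.
Qed.

Lemma tau_generators s : indep_generators s -> indep_generators (act tau s).
Proof.
move=> Is; repeat (case: Is => [Is|->]; last first);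
  last (rewrite Is {s Is}); rewrite /t_1 /tm_1 /t_2 /tm_2 /t_3 /tm_3 /t_4 /tm_4
    act_tr /tau /= /tau_fun !(F2_endoM, F2_endoV, F2_endo1, F2_endo2) //;
  rewrite /indep_generators /t_1 /tm_1 /t_2 /tm_2 /t_3 /tm_3 /t_4 /tm_4 /=;
  try (by rewrite (tr_wordC x2); intuition);
  try (by rewrite (tr_wordC x2^-1); intuition); by intuition.
Qed.

Lemma iota_generators s : indep_generators s -> indep_generators (act iota s).
Proof.
move=> Is; repeat (case: Is => [Is|->]; last first);
  last (rewrite Is {s Is}); rewrite /t_1 /tm_1 /t_2 /tm_2 /t_3 /tm_3 /t_4 /tm_4
    act_tr /iota /= /iota_fun !(F2_endoM, F2_endoV, F2_endo1, F2_endo2, invgK) //;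
  rewrite /indep_generators /t_1 /tm_1 /t_2 /tm_2 /t_3 /tm_3 /t_4 /tm_4 /=;
  by intuition.
Qed.

Lemma act_comp alpha beta f : act (alpha * beta) f = act alpha (act beta f).
Proof. by rewrite actM. Qed.

Lemma frakD_generators alpha : frakD alpha ->
  (forall s, indep_generators s -> indep_generators (act alpha s)) /\
  (forall s, indep_generators s -> indep_generators (act alpha^-1 s)).
Proof.
pose H : {pred grpAut F2} := fun alpha =>
  `[< (forall s, indep_generators s -> indep_generators (act alpha s)) /\
  (forall s, indep_generators s -> indep_generators (act alpha^-1 s)) >].
move/(_ H) => HD; apply/asboolP/HD.
  split=> [|a b /asboolP[aI aI'] /asboolP[bI bI']]; apply/asboolP.
    by rewrite invg1; split=> s; rewrite (act_fun1 s : act 1 s = s).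
  rewrite invgM invgK; split=> s sI; rewrite act_comp; [exact/aI/bI' | exact/bI/aI'].
move=> s [->|->]; apply/asboolP.
  by rewrite tauV; split; apply: tau_generators.
by rewrite iotaV; split; apply: iota_generators.
Qed.

Lemma act_gen_subalg alpha (S : set charRing) :
  (forall s, S s -> S (act alpha s)) ->
  forall r, r \in gen_subalg S -> act alpha r \in gen_subalg S.
Proof.
move=> aS r /asboolP rS.
have [actL [act1 actM']] := asboolW (algaut_symP (act alpha)).
have [g1 gL gM] := gen_subalg_closed S.
apply: (rS (fun f => act alpha f \in gen_subalg S)) => [|s Ss].
  split=> [|k f h fS hS|f h fS hS].
  - suff : act alpha 1%R \in gen_subalg S by [].
    by rewrite [act alpha 1%R]act1.
  - suff : act alpha (k *: f + h)%R \in gen_subalg S by [].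
    by rewrite [act alpha _]actL; apply: gL.
  - suff : act alpha (f * h)%R \in gen_subalg S by [].
    by rewrite [act alpha _]actM'; apply: gM.
exact/gen_subalg_sub/aS.
Qed.

Lemma frakD_restrict alpha : frakD alpha ->
  exists rho : algAut ringR, forall r : ringR, val (rho r) = act alpha (val r).
Proof.
move=> /frakD_generators[aI aI'].
pose f (r : ringR) : ringR := Subalg (act_gen_subalg aI (subalg_valP r)).
pose g (r : ringR) : ringR := Subalg (act_gen_subalg aI' (subalg_valP r)).
have fK : cancel f g by move=> r; apply: val_inj; apply: act_funK.
have gK : cancel g f by move=> r; apply: val_inj; apply: act_funVK.
have fP : SymT fK gK \in @is_algaut K ringR.
  have [actL [act1 actM']] := asboolW (algaut_symP (act alpha)).
  apply/asboolP; split=> [k x y|]; first exact/val_inj/actL.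
  by split=> [|x y]; apply: val_inj; [exact: act1 | exact: actM'].
by exists (AlgAut fP).
Qed.

(* By frakD_restrict, every alpha in frakD has a restriction rho to R. *)
Definition frakD_R : set (algAut ringR) :=
  [set rho | exists2 alpha, frakD alpha &
     forall r : ringR, val (rho r) = act alpha (val r)].

(* Each element of frakD restricts to a permutation of S. *)
Definition acts_by_permutations (S : set charRing) : Prop :=
  forall alpha, frakD alpha -> set_bij S S (act alpha).

End CharacterRing.

Arguments indep_generators K : clear implicits.
Arguments generators K : clear implicits.
Arguments ringR K : clear implicits.
Arguments frakD_R K : clear implicits.

(* Main.v *)
(* Signed permutations of {x1, x2}, i.e. the permutations of the four letters *)
(* x1, x1^-1, x2, x2^-1 that commute with inversion, extend to automorphisms  *)
(* of F_2; tau and iota come from the swap of the indices and a sign change,  *)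
(* which are two involutions generating a dihedral group of order 8.  This    *)
(* group acts faithfully on R because the traces of the four letters are      *)
(* pairwise distinct functions.  Finally, tau maps t_5 to the trace of the    *)
(* inverse commutator, which is not one of the nine generators; both          *)
(* non-equalities are seen at a single pair of integer matrices.              *)

Require Import Defs.
From HB Require Import structures.
From mathcomp Require Import all_boot all_order all_algebra all_fingroup.
From mathcomp Require Import all_solvable.
From mathcomp Require Import complex.
From mathcomp Require Import boolp classical_sets functions reals.
From mathcomp Require Import ring.

Set Implicit Arguments.
Unset Strict Implicit.
Unset Printing Implicit Defensive.

Import GRing.Theory Num.Theory.

Local Open Scope classical_set_scope.

(** A signed permutation of the letters of a free group extends to an automorphism, and [letter_aut]
    makes this a group morphism. In rank two, [tau] and [iota] are the images of [swap_perm] and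
    [flip_perm], so [frakD] is the image of the group [dihedral_perms] they generate
    ([frakD_letter_aut], [letter_aut_frakD]). That group has order 8, since its elements correspond
    to pairs of letters with different indices, and two involutions generate it, so it is dihedral
    ([dihedral_perms_isog]). Restriction to R loses nothing: R contains the traces of x1 and x2,
    whose images are traces of letters, and these determine the letters ([tr_word_letter_inj]).

    For the second claim, [tau] and [iota] permute the eight independent generators. A stable subset
    of the nine generators cannot contain [t_5], because [tau] sends it outside the nine
    ([act_tau_t_5]). *)

(** * Automorphisms of a free group from signed permutations of its letters *)

Section SignedPermutations.
Local Open Scope group_scope.
Variable X : finType.
Implicit Types (a : X * bool) (g h : {perm X * bool}).

Definition letter_word a : freeGroup X := @FreeGroup X [:: a] isT.

Lemma letter_wordV a : (letter_word a)^-1 = letter_word (letterV a).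
Proof. exact: val_inj. Qed.

Lemma letter_wordE a :
  letter_word a = if a.2 then (fg_gen a.1)^-1 else fg_gen a.1.
Proof. by apply: val_inj; case: a => x []. Qed.

Definition letterV_perm : {perm X * bool} := perm (inv_inj (@letterVK X)).

Local Notation B := 'C[letterV_perm].

Lemma signed_permV g a : g \in B -> g (letterV a) = letterV (g a).
Proof.
by move=> /cent1P/permP/(_ a); rewrite !permM !permE.
Qed.

Lemma signed_permP g : (forall a, g (letterV a) = letterV (g a)) -> g \in B.
Proof.
by move=> gV; apply/cent1P/permP => a; rewrite !permM !permE gV.
Qed.

Definition letter_endo g : freeGroup X -> freeGroup X :=
  fg_lift (fun x => letter_word (g (x, false))).

Lemma letter_endoM g : {morph letter_endo g : u v / u * v}.
Proof. exact: fg_liftM. Qed.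

(** The construction prescribes only the images of positive letters; commuting with inversion
    extends the formula to the inverse letters. *)
Lemma letter_endoE g a : g \in B ->
  letter_endo g (letter_word a) = letter_word (g a).
Proof.
move=> gB; rewrite letter_wordE; case: a => x [] /=; last exact: fg_lift_gen.
rewrite (gmorph_inv (letter_endoM g)) [X in X^-1]fg_lift_gen letter_wordV.
by rewrite -signed_permV.
Qed.

Lemma letter_endo_comp g h w : g \in B ->
  letter_endo g (letter_endo h w) = letter_endo (h * g) w.
Proof.
move=> gB; move: w; apply: fg_ext => [u v|u v|x]; rewrite ?letter_endoM //.
by rewrite [letter_endo h _]fg_lift_gen letter_endoE // [RHS]fg_lift_gen permM.
Qed.

Lemma letter_endo1 w : letter_endo 1 w = w.
Proof.
move: w; apply: fg_ext => [u v|u v|x] //; first exact: letter_endoM.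
by rewrite [LHS]fg_lift_gen perm1; apply: val_inj.
Qed.

Lemma letter_endoK g : g \in B -> cancel (letter_endo g) (letter_endo g^-1).
Proof. by move=> gB w; rewrite letter_endo_comp ?groupV // mulgV letter_endo1. Qed.

Lemma letter_endoVK g : g \in B -> cancel (letter_endo g^-1) (letter_endo g).
Proof. by move=> gB w; rewrite letter_endo_comp // mulVg letter_endo1. Qed.

Definition letter_sym (u : subg_of B%G) : symT (freeGroup X) :=
  SymT (letter_endoVK (subgP u)) (letter_endoK (subgP u)).

Lemma letter_symP u : letter_sym u \in @is_gaut (freeGroup X).
Proof. exact/asboolP/letter_endoM. Qed.

(* The inverse turns the right action of permutations into a left action.     *)
Definition letter_aut (u : subg_of B%G) : grpAut (freeGroup X) :=
  GrpAut (letter_symP u).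

Lemma letter_autE u a :
  letter_aut u (letter_word a) = letter_word ((sgval u)^-1 a).
Proof. by apply: letter_endoE; rewrite groupV subgP. Qed.

Lemma letter_autM : {morph letter_aut : u v / u * v}.
Proof.
move=> u v; apply/val_inj/symP => w /=.
by rewrite letter_endo_comp ?groupV ?subgP // -invMg.
Qed.

End SignedPermutations.

(** * The dihedral group of signed permutations in rank two, and its image [frakD] *)

Section Dihedral.
Local Notation F2 := (freeGroup 'I_2).
Local Open Scope group_scope.
Local Notation letters := ('I_2 * bool)%type.
Local Notation B := 'C[letterV_perm 'I_2].

Definition swap_letter (a : letters) : letters := (rev_ord a.1, a.2).
Definition flip_letter (a : letters) : letters := (a.1, (a.1 == ord0) (+) a.2).

Lemma swap_letterK : involutive swap_letter.
Proof. by case=> i b; rewrite /swap_letter /= rev_ordK. Qed.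

Lemma flip_letterK : involutive flip_letter.
Proof. by case=> i b; rewrite /flip_letter /= addKb. Qed.

Definition swap_perm : {perm letters} := perm (inv_inj swap_letterK).
Definition flip_perm : {perm letters} := perm (inv_inj flip_letterK).

Lemma swap_permV : swap_perm^-1 = swap_perm.
Proof.
by apply: (mulgI swap_perm); rewrite mulgV; apply/permP => a;
  rewrite permM !permE swap_letterK.
Qed.

Lemma flip_permV : flip_perm^-1 = flip_perm.
Proof.
by apply: (mulgI flip_perm); rewrite mulgV; apply/permP => a;
  rewrite permM !permE flip_letterK.
Qed.

Definition dihedral_perms : {group {perm letters}} :=
  <<[set swap_perm; flip_perm]%SET>>%G.

Lemma swap_in : swap_perm \in dihedral_perms.
Proof. by rewrite mem_gen ?set21. Qed.

Lemma flip_in : flip_perm \in dihedral_perms.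
Proof. by rewrite mem_gen ?set22. Qed.

Lemma dihedral_perms_signed : dihedral_perms \subset B.
Proof.
rewrite gen_subG; apply/fintype.subsetP => g /set2P[] ->; apply: signed_permP => a.
  by rewrite !permE.
by rewrite !permE /flip_letter /letterV /= addbN.
Qed.

Definition first_images (g : {perm letters}) : letters * letters :=
  (g (ord0, false), g (ord_max, false)).

Lemma first_images_inj : {in B &, injective first_images}.
Proof.
move=> g h gB hB [g0 g1]; apply/permP => -[i b].
have pos j : g (j, false) = h (j, false).
  case: j => -[|[|//]] lt_j.
  - by rewrite (_ : Ordinal lt_j = ord0) //; apply: val_inj.
  - by rewrite (_ : Ordinal lt_j = ord_max) //; apply: val_inj.
case: b => //; rewrite (_ : (i, true) = letterV (i, false)) //.
by rewrite !signed_permV // pos.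
Qed.

(** This turns the order of the group into a count: four choices for the first letter, then two for
    a letter of the other index. *)
Lemma first_images_dihedral :
  first_images @: dihedral_perms =
  [set p : letters * letters | p.1.1 != p.2.1]%SET.
Proof.
apply/setP => p; rewrite inE; apply/imsetP/idP => [[g gD ->] | ] /=.
  have gB := fintype.subsetP dihedral_perms_signed g gD.
  (* With equal indices, x1 would have the same image as x2 or its inverse, against injectivity. *)
  apply/eqP => eq01; have : g (ord0, false) \in [:: g (ord_max, false);
      g (letterV (ord_max, false))].
    rewrite signed_permV // !inE; move: eq01.
    case: (g _) (g _) => [i b] [j c] /= ->.
    by rewrite /letterV /= !xpair_eqE !eqxx; case: b c => [] [].
  by rewrite !inE !(inj_eq perm_inj).
have im g : g \in dihedral_perms -> p = first_images g ->
    exists2 g, g \in dihedral_perms & p = first_images g by exists g.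
have [s t] := (swap_in, flip_in).
case: p im => -[i b] [j c] /= im ij.
have [[Ei Ej]|[Ei Ej]] :
    i = ord0 /\ j = ord_max \/ i = ord_max /\ j = ord0.
- case: i j ij {im} => -[|[|//]] lt_i [[|[|//]] lt_j] // _;
  by [left; split; apply: val_inj | right; split; apply: val_inj].
(* An explicit word in the two involutions, read from left to right, realises each of the eight
   pairs. *)
- move: im; rewrite {}Ei {}Ej {i j ij}; case: b c => [] [] im.
  + apply: (im (swap_perm * flip_perm * swap_perm * flip_perm)).
      by rewrite !groupM.
    by rewrite /first_images !permM !permE; congr ((_, _), (_, _)); apply: val_inj.
  + apply: (im flip_perm) => //.
    by rewrite /first_images !permE; congr ((_, _), (_, _)); apply: val_inj.
  + apply: (im (swap_perm * flip_perm * swap_perm)); first by rewrite !groupM.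
    by rewrite /first_images !permM !permE; congr ((_, _), (_, _)); apply: val_inj.
  + apply: (im 1) => //.
    by rewrite /first_images !perm1.
- move: im; rewrite {}Ei {}Ej {i j ij}; case: b c => [] [] im.
  + apply: (im (flip_perm * swap_perm * flip_perm)); first by rewrite !groupM.
    by rewrite /first_images !permM !permE; congr ((_, _), (_, _)); apply: val_inj.
  + apply: (im (flip_perm * swap_perm)); first by rewrite !groupM.
    by rewrite /first_images !permM !permE; congr ((_, _), (_, _)); apply: val_inj.
  + apply: (im (swap_perm * flip_perm)); first by rewrite !groupM.
    by rewrite /first_images !permM !permE; congr ((_, _), (_, _)); apply: val_inj.
  + apply: (im swap_perm) => //.
    by rewrite /first_images !permE; congr ((_, _), (_, _)); apply: val_inj.
Qed.

Lemma card_dihedral_perms : #|dihedral_perms| = 8.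
Proof.
rewrite -(card_in_imset (f := first_images)); last first.
  by apply: sub_in2 first_images_inj; apply/fintype.subsetP/dihedral_perms_signed.
rewrite first_images_dihedral -sum1dep_card big_mkcond.
rewrite -(pair_bigA _ (fun a b : letters => nat_of_bool (a.1 != b.1))) /=.
rewrite -(pair_bigA _ (fun i b => \sum_(a : letters) nat_of_bool (i != a.1))).
under eq_bigr => i _.
  under eq_bigr => b _ do
    rewrite -(pair_bigA _ (fun (j : 'I_2) (c : bool) => nat_of_bool (i != j))).
  over.
by rewrite /= !(big_ord_recl, big_ord0, big_bool).
Qed.

(** Two distinct involutions always generate a dihedral group, so its order settles its isomorphism
    type; ['D_8] is indexed by that order. *)
Lemma dihedral_perms_isog : 'D_8 \isog dihedral_perms.
Proof.
have invol (g : {perm letters}) a : g^-1 = g -> g a != a -> #[g] = 2.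
  move=> gV ga; apply/prime.prime_nt_dvdP => //.
    by apply: contra ga; rewrite order_eq1 => /eqP->; rewrite perm1.
  by rewrite order_dvdn -eq_invg_mul gV.
have := @involutions_gen_dihedral _ swap_perm flip_perm.
rewrite /= -[<<_>>]/(gval dihedral_perms) card_dihedral_perms isog_sym; apply.
- by apply: (invol _ (ord0, false) swap_permV); rewrite permE.
- by apply: (invol _ (ord0, false) flip_permV); rewrite permE.
- by apply/eqP => /permP/(_ (ord0, false)); rewrite !permE.
Qed.

Lemma x1_letter : x1 = letter_word (ord0, false).
Proof. exact: val_inj. Qed.

Lemma x2_letter : x2 = letter_word (ord_max, false).
Proof. exact: val_inj. Qed.

Lemma letter_aut_eq (u : subg_of B) (alpha : grpAut F2) :
  letter_word ((sgval u)^-1 (ord0, false)) = alpha x1 ->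
  letter_word ((sgval u)^-1 (ord_max, false)) = alpha x2 ->
  letter_aut u = alpha.
Proof.
move=> u1 u2; apply/val_inj/symP/F2_ext; try exact: gautM.
  by rewrite {1}x1_letter letter_autE.
by rewrite {1}x2_letter letter_autE.
Qed.

Lemma letter_aut_swap : letter_aut (subg _ swap_perm) = tau.
Proof.
have sB := fintype.subsetP dihedral_perms_signed _ swap_in.
apply: letter_aut_eq; rewrite subgK // swap_permV permE /= /tau_fun.
  by rewrite F2_endo1; apply: val_inj; congr [:: (_, _)]; apply: val_inj.
by rewrite F2_endo2; apply: val_inj; congr [:: (_, _)]; apply: val_inj.
Qed.

Lemma letter_aut_flip : letter_aut (subg _ flip_perm) = Defs.iota.
Proof.
have sB := fintype.subsetP dihedral_perms_signed _ flip_in.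
apply: letter_aut_eq; rewrite subgK // flip_permV permE /= /iota_fun.
  by rewrite F2_endo1; apply: val_inj.
by rewrite F2_endo2; apply: val_inj.
Qed.

Lemma frakD_letter_aut (g : {perm letters}) :
  g \in dihedral_perms -> frakD (letter_aut (subg _ g)).
Proof.
move=> gD H Hcl Hgen; have [H1 _] := Hcl.
(* The preimage of [H] is a group containing both involutions, hence all of [dihedral_perms]. *)
pose D := [set h in B | letter_aut (subg [group of B] h) \in H]%SET.
have DE h : (h \in D) = (h \in B) && (letter_aut (subg _ h) \in H).
  by rewrite finset.in_set.
have Dgroup : group_set D.
  apply/group_setP; split=> [|h k]; rewrite !DE.
    rewrite group1 /= (_ : subg _ 1 = 1) ?(gmorph_one (@letter_autM _)) //.
    exact: morph1.
  move=> /andP[hB hH] /andP[kB kH]; rewrite groupM //= morphM //.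
  by rewrite letter_autM; apply: group_closedM.
suff: g \in Group Dgroup by rewrite DE => /andP[].
apply: fintype.subsetP gD; rewrite gen_subG; apply/fintype.subsetP => h.
case/set2P => ->; rewrite DE (fintype.subsetP dihedral_perms_signed) //=.
- by rewrite letter_aut_swap; apply: Hgen; left.
- exact: swap_in.
- by rewrite letter_aut_flip; apply: Hgen; right.
- exact: flip_in.
Qed.

Lemma letter_aut_frakD (alpha : grpAut F2) : frakD alpha ->
  exists2 g, g \in dihedral_perms & alpha = letter_aut (subg _ g).
Proof.
pose H : {pred grpAut F2} := fun alpha =>
  `[< exists2 g, g \in dihedral_perms & alpha = letter_aut (subg _ g) >].
move/(_ H) => HD; apply/asboolP/HD.
  split=> [|_ _ /asboolP[g gD ->] /asboolP[h hD ->]]; apply/asboolP.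
    exists 1; rewrite ?group1 // (_ : subg _ 1 = 1) ?morph1 //.
    by rewrite (gmorph_one (@letter_autM _)).
  exists (g * h^-1); first by rewrite groupM ?groupV.
  have [gB hB] := (fintype.subsetP dihedral_perms_signed _ gD,
                   fintype.subsetP dihedral_perms_signed _ hD).
  by rewrite morphM ?groupV // morphV // letter_autM (gmorph_inv (@letter_autM _)).
move=> _ [->|->]; apply/asboolP.
- by exists swap_perm; rewrite ?swap_in // letter_aut_swap.
- by exists flip_perm; rewrite ?flip_in // letter_aut_flip.
Qed.

End Dihedral.

(** * Explicit 3 by 3 matrices *)

Section Matrices3.
Local Open Scope ring_scope.
Variable K : comNzRingType.

Definition mx3 (a b c d e f g h i : K) : 'M[K]_3 :=
  \matrix_(k, l)
    (nth [::] [:: [:: a; b; c]; [:: d; e; f]; [:: g; h; i]] k)`_l.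

Lemma mul_mx3 a b c d e f g h i a' b' c' d' e' f' g' h' i' :
  mx3 a b c d e f g h i *m mx3 a' b' c' d' e' f' g' h' i' =
  mx3 (a * a' + b * d' + c * g') (a * b' + b * e' + c * h')
      (a * c' + b * f' + c * i')
      (d * a' + e * d' + f * g') (d * b' + e * e' + f * h')
      (d * c' + e * f' + f * i')
      (g * a' + h * d' + i * g') (g * b' + h * e' + i * h')
      (g * c' + h * f' + i * i').
Proof.
apply/matrixP => k l; rewrite mxE !big_ord_recl big_ord0 !mxE /= addr0 addrA.
by case: k => -[|[|[|//]]] ?; case: l => -[|[|[|//]]] ?.
Qed.

Lemma trace_mx3 a b c d e f g h i : \tr (mx3 a b c d e f g h i) = a + e + i.
Proof. by rewrite /mxtrace !big_ord_recl big_ord0 !mxE /= addr0 addrA. Qed.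

Lemma mx3_1 : mx3 1 0 0 0 1 0 0 0 1 = 1%:M.
Proof.
apply/matrixP => k l; rewrite !mxE.
by case: k => -[|[|[|//]]] ?; case: l => -[|[|[|//]]] ?.
Qed.

Lemma det_mx3 a b c d e f g h i :
  \det (mx3 a b c d e f g h i) =
  a * (e * i - f * h) - b * (d * i - f * g) + c * (d * h - e * g).
Proof.
rewrite (expand_det_row _ ord0) !big_ord_recl big_ord0 /cofactor.
rewrite !(expand_det_row _ ord0) !big_ord_recl !big_ord0 /cofactor !det_mx11.
by rewrite !mxE /=; ring.
Qed.

End Matrices3.

(** * Traces separated at one pair of integer matrices *)

Section Traces.
Local Open Scope ring_scope.
Variable K : numFieldType.

Lemma det_witness1 : \det (mx3 (-2) 1 1 1 0 0 0 1 0 : 'M[K]_3) == 1.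
Proof. by apply/eqP; rewrite det_mx3; ring. Qed.
Lemma det_witness1V : \det (mx3 0 1 0 0 0 1 1 2 (-1) : 'M[K]_3) == 1.
Proof. by apply/eqP; rewrite det_mx3; ring. Qed.
Lemma det_witness2 : \det (mx3 0 0 1 1 0 0 0 1 1 : 'M[K]_3) == 1.
Proof. by apply/eqP; rewrite det_mx3; ring. Qed.
Lemma det_witness2V : \det (mx3 0 1 0 (-1) 0 1 1 0 0 : 'M[K]_3) == 1.
Proof. by apply/eqP; rewrite det_mx3; ring. Qed.

(* Found by a search among small integer matrices: here t_1, tm_1, t_2, tm_2, *)
(* t_3, tm_3, t_4, tm_4, t_5 take the values -2, -1, 1, 0, 1, 1, 2, 2, 5,     *)
(* while the trace of the inverse commutator is 3.                            *)
Definition witness1 : SL K 3 := MkSL det_witness1.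
Definition witness2 : SL K 3 := MkSL det_witness2.
Definition witness : (SL K 3 * SL K 3)%type := (witness1, witness2).

Lemma witness1V : (witness1^-1)%g = MkSL det_witness1V.
Proof.
apply: mulg1_eq; apply/val_inj; rewrite /= mul_mx3 -mx3_1.
by congr mx3; ring.
Qed.

Lemma witness2V : (witness2^-1)%g = MkSL det_witness2V.
Proof.
apply: mulg1_eq; apply/val_inj; rewrite /= mul_mx3 -mx3_1.
by congr mx3; ring.
Qed.

Lemma eval_witness1 : eval_word witness x1 = witness1.
Proof. exact: eval_word1. Qed.

Lemma eval_witness2 : eval_word witness x2 = witness2.
Proof. exact: eval_word2. Qed.

Definition eval_witnessE := (@eval_wordM K witness, @eval_wordV K witness,
  eval_witness1, eval_witness2, witness1V, witness2V).

Definition letter_trace (a : 'I_2 * bool) : int :=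
  if a.1 == ord0 then if a.2 then -1 else -2 else if a.2 then 0 else 1.

Lemma letter_trace_inj : injective letter_trace.
Proof.
have I2P (i : 'I_2) : i = ord0 \/ i = ord_max.
  by case: i => -[|[|//]] ?; [left | right]; apply: val_inj.
by case=> i b [j c]; case: (I2P i) (I2P j) => -> [] ->; case: b c => [] [].
Qed.

Lemma trace_letter (a : 'I_2 * bool) :
  trace_fun (K := K) (letter_word a) witness = (letter_trace a)%:~R.
Proof.
rewrite /trace_fun /letter_trace.
case: a => -[[|[|//]] lt_i] b /=.
  rewrite (_ : Ordinal lt_i = ord0); last exact: val_inj.
  by case: b; rewrite letter_wordE !eval_witnessE /= trace_mx3; ring.
rewrite (_ : Ordinal lt_i = ord_max); last exact: val_inj.
by case: b; rewrite letter_wordE !eval_witnessE /= trace_mx3; ring.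
Qed.

(** At [witness] the four letters have distinct integer traces, which stay distinct in [K] by
    characteristic zero. *)
Lemma tr_word_letter_inj a b :
  tr_word K (letter_word a) = tr_word K (letter_word b) -> a = b.
Proof.
move/(congr1 (fun f : charRing K => char_fun f witness)); rewrite /= !trace_letter.
by move/intr_inj/letter_trace_inj.
Qed.

Lemma act_tau_t_5 : ~ generators K (Defs.act K tau (t_5 K)).
Proof.
(* The image of [t_5] under [tau] is the trace of the inverse commutator, with value 3 at
   [witness]. *)
have neq w n : trace_fun w witness = n%:~R -> (n != 3 :> int) ->
    Defs.act K tau (t_5 K) <> tr_word K w.
  move=> wn n3; rewrite act_tr /= /tau_fun !(F2_endoM, F2_endoV, F2_endo1, F2_endo2).
  move/(congr1 (fun f : charRing K => char_fun f witness)); rewrite /= wn /trace_fun.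
  rewrite !eval_witnessE /= !mul_mx3 trace_mx3 => E.
  by case/eqP: n3; apply: (@intr_inj K); rewrite -E; ring.
case=> [|[[[[[[[]|]|]|]|]|]|]]; [apply: (neq _ 5) | apply: (neq _ (-2))
  | apply: (neq _ (-1)) | apply: (neq _ 1) | apply: (neq _ 0) | apply: (neq _ 1)
  | apply: (neq _ 1) | apply: (neq _ 2) | apply: (neq _ 2)] => //;
  by rewrite /trace_fun !eval_witnessE /= ?mul_mx3 trace_mx3; ring.
Qed.

End Traces.

(** * The action on R and on the generators *)

Section Main.
Local Open Scope group_scope.
Variable K : numFieldType.

Lemma acts_by_permutations_indep : acts_by_permutations (indep_generators K).
Proof.
move=> alpha /(@frakD_generators K)[aI aI']; split=> [s /aI //| s t _ _|s sI] /=.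
  exact: (can_inj (@symK _ (Defs.act K alpha))).
by exists (Defs.act K alpha^-1 s); [exact: aI' | exact: act_funVK].
Qed.

Lemma acts_by_permutations_sub (S : set (charRing K)) :
  S `<=` generators K -> acts_by_permutations S -> S `<=` indep_generators K.
Proof.
move=> Sgen Sact s Ss; case: (Sgen s Ss) => // s5; case: (@act_tau_t_5 K).
have tauD : frakD tau by move=> H _; apply; left.
by apply: Sgen; rewrite -s5; have [Sfun _ _] := Sact _ tauD; apply: Sfun.
Qed.

Lemma frakD_R_dihedral : set_isog ('D_8)%type (frakD_R K).
Proof.
have [f injf fD] := isogP dihedral_perms_isog.
have f_in (d : ('D_8)%type) : f d \in dihedral_perms by rewrite -fD mem_morphim ?inE.
pose theta (d : ('D_8)%type) := letter_aut (subg _ (f d)).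
have f_signed (d : ('D_8)%type) := fintype.subsetP dihedral_perms_signed _ (f_in d).
have thetaM : {morph theta : x y / x * y}.
  by move=> x y; rewrite /theta morphM ?inE // morphM ?f_signed // letter_autM.
have theta_frakD d : frakD (theta d) by apply: frakD_letter_aut.
pose phi d := projT1 (cid (@frakD_restrict K _ (theta_frakD d))).
have phiE d r : val (phi d r) = Defs.act K (theta d) (val r).
  exact: (projT2 (cid (@frakD_restrict K _ (theta_frakD d)))).
(* A restriction to R is unique, so the chosen ones inherit multiplicativity from [theta]. *)
have eq_phi d (rho : algAut (ringR K)) :
    (forall r, val (rho r) = Defs.act K (theta d) (val r)) -> phi d = rho.
  by move=> rhoE; apply/val_inj/symP => r; apply: val_inj; rewrite phiE rhoE.
have phiM : {morph phi : x y / x * y}.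
  move=> x y; apply: eq_phi => r.
  by rewrite thetaM [RHS]act_comp [LHS]phiE phiE.
pose phi_mult := isMultiplicative.Build _ _ phi phiM.
exists (HB.pack phi phi_mult : {multiplicative ('D_8)%type -> algAut (ringR K)}).
  move=> /= x y eq_xy.
  (* Injectivity: the traces of x1 and x2 lie in R, and their images under [phi d] reveal where the
     inverse of [f d] sends the positive letters. *)
  have letters_eq i : (f x)^-1 (i, false) = (f y)^-1 (i, false).
    have tr_in : indep_generators K (tr_word K (letter_word (i, false))).
      case: i => -[|[|//]] lt_i.
        rewrite (_ : Ordinal lt_i = ord0) -?x1_letter; last exact: val_inj.
        by do 7 left.
      rewrite (_ : Ordinal lt_i = ord_max) -?x2_letter; last exact: val_inj.
      by do 5 left; right.
    apply: (@tr_word_letter_inj K).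
    have act_letter d : val (phi d (Subalg (gen_subalg_sub tr_in))) =
        tr_word K (letter_word ((f d)^-1 (i, false))).
      by rewrite phiE act_tr letter_autE subgK ?f_signed.
    by rewrite -!act_letter eq_xy.
  have fV_signed d : (f d)^-1 \in 'C[letterV_perm 'I_2] by rewrite groupV f_signed.
  apply: (injmP injf); rewrite ?inE //; apply: invg_inj.
  by apply: first_images_inj; rewrite ?fV_signed // /first_images !letters_eq.
apply/seteqP; split=> [_ [d _ <-]|rho [alpha /letter_aut_frakD[g gD ->] rhoE]] /=.
  by exists (theta d).
have /morphimP[d _ _ gd] : g \in f @* [set: 'D_8]%SET by rewrite fD.
by exists d => //; apply: eq_phi => r; rewrite rhoE gd.
Qed.

End Main.

Theorem theorem13 (R : realType) :
  set_isog 'D_8%type (frakD_R R[i]) /\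
  (acts_by_permutations (indep_generators R[i]) /\
   forall S : set (charRing R[i]),
     S `<=` generators R[i] -> acts_by_permutations S ->
     S `<=` indep_generators R[i]).
Proof.
split; first exact: frakD_R_dihedral.
by split=> [|S]; [exact: acts_by_permutations_indep | exact: acts_by_permutations_sub].
Qed.
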